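(* Let $\mathfrak{g}$ be a finite-dimensional real or complex semisimple Lie algebra. Suppose that $a \in \mathfrak{g}$ belongs to a sheet $S$ of $\mathfrak{g}$, and that $S$ is smooth at the point $a$. Then the derived algebra of the centralizer of $a$ is orthogonal to $S$ at the point $a$: $$\langle\, [\mathfrak{g}^a, \mathfrak{g}^a], \mathrm{T}_a S \,\rangle = 0.$$
   Context: For $a \in \mathfrak{g}$, $\mathfrak{g}^a = \{x \in \mathfrak{g} \mid [a,x] = 0\}$ is the centralizer of $a$. For an integer $k$, $\mathfrak{g}^{(k)} = \{a \in \mathfrak{g} \mid \dim \mathfrak{g}^a = k\}$, which is a quasi-affine algebraic variety (the union of all adjoint orbits of codimension $k$). The sheets of $\mathfrak{g}$ are the irreducible components of the varieties $\mathfrak{g}^{(k)}$. The tangent space $\mathrm{T}_aS$ is regarded as a subspace of $\mathfrak{g}$, and $\langle\cdot,\cdot\rangle$ is the Killing form of $\mathfrak{g}$. *)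

(* Defs.v *)
From HB Require Import structures.
From mathcomp Require Import all_boot all_order all_algebra.
From mathcomp Require Import boolp classical_sets reals complex.
From mathcomp Require Import mpoly.

Set Implicit Arguments.
Unset Strict Implicit.
Unset Printing Implicit Defensive.

Import GRing.Theory.

Local Open Scope ring_scope.
Local Open Scope classical_set_scope.

Variant real_or_complex : fieldType -> Prop :=
  | RealField (R : realType) : real_or_complex R
  | ComplexField (R : realType) : real_or_complex R[i].

HB.mixin Record Vector_isLie (K : fieldType) g of Vector K g := {
  lie : g -> g -> g;
  lie_is_linearl : forall y, linear (lie^~ y);
  lie_is_linearr : forall x, linear (lie x);
  liexx : forall x, lie x x = 0;
  lie_jacobi : forall x y z,
    lie x (lie y z) + lie y (lie z x) + lie z (lie x y) = 0
}.

#[short(type="lieType")]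
HB.structure Definition Lie (K : fieldType) := {g of Vector K g & Vector_isLie K g}.

Section LieAlgebra.
Context {K : fieldType} {g : lieType K}.
Implicit Types (a x y z : g) (U V I : {vspace g}).

HB.instance Definition _ x :=
  GRing.isLinear.Build K g g *:%R (lie x) (lie_is_linearr x).

Definition ad x : 'End(g) := linfun (lie x).

Definition centralizer a : {vspace g} := lker (ad a).

Lemma mem_centralizer a x : (x \in centralizer a) = (lie a x == 0).
Proof. by rewrite memv_ker lfunE. Qed.

(* Brackets of basis vectors suffice, by bilinearity; compare [prodv]. *)
Definition lie_prodv U V : {vspace g} :=
  <<[seq lie u v | u <- vbasis U, v <- vbasis V]>>%VS.

Definition derived_algebra U : {vspace g} := lie_prodv U U.

Lemma memv_lie U V x y : x \in U -> y \in V -> lie x y \in lie_prodv U V.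
Proof.
move=> Ux /coord_vbasis ->.
rewrite linear_sum memv_suml // => j _; rewrite linearZ memvZ //=.
set w := _`_j; rewrite {Ux}(coord_vbasis Ux).
pose f : {linear g -> g} := HB.pack (lie^~ w)
  (GRing.isLinear.Build K g g *:%R (lie^~ w) (lie_is_linearl w)).
rewrite -[lie _ w]/(f _) linear_sum memv_suml // => i _.
by rewrite linearZ memvZ //= memv_span // allpairs_f ?memt_nth.
Qed.

Definition lie_ideal I : bool := (lie_prodv {:g} I <= I)%VS.

Definition lie_solvable U : Prop := exists n, iter n derived_algebra U = 0%VS.

Definition lie_semisimple : Prop :=
  forall I, lie_ideal I -> lie_solvable I -> I = 0%VS.

Definition killing x y : K :=
  \tr (passmx.mxof (vbasis {:g}) (vbasis {:g}) (ad x \o ad y)%VF).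

End LieAlgebra.

Arguments lie_semisimple {K} g.

Section Zariski.
Context {K : fieldType} {g : vectType K}.
Implicit Types (p : {mpoly K[\dim {:g}]}) (x v a : g) (X Z S : set g).

Definition peval p x : K := p.@[fun i => coord (vbasis {:g}) i x].

Definition pdiff p x v : K :=
  \sum_i peval p^`M(i) x * coord (vbasis {:g}) i v.

Definition zariski_closed Z : Prop :=
  exists F : set {mpoly K[\dim {:g}]},
    Z = [set x | forall p, F p -> peval p x = 0].

Definition closed_in X Z : Prop := exists2 C, zariski_closed C & Z = X `&` C.

(* Irreducibility for the topology induced on [X] by the Zariski topology. *)
Definition irreducible X : Prop :=
  X !=set0 /\
  forall C1 C2, zariski_closed C1 -> zariski_closed C2 ->
    X `<=` C1 `|` C2 -> X `<=` C1 \/ X `<=` C2.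

Definition irreducible_component X S : Prop :=
  [/\ S `<=` X, irreducible S &
      forall Z, Z `<=` X -> irreducible Z -> S `<=` Z -> Z = S].

Definition irreducible_chain X n (W : nat -> set g) : Prop :=
  (forall i, (i <= n)%N -> irreducible (W i) /\ closed_in X (W i)) /\
  (forall i, (i < n)%N -> W i `<` W i.+1).

Definition krull_dim X n : Prop :=
  (exists W, irreducible_chain X n W) /\
  (forall m W, irreducible_chain X m W -> (m <= n)%N).

Definition tangent_space S a : set g :=
  [set v | forall p, (forall x, S x -> peval p x = 0) -> pdiff p a v = 0].

(* [S] is meant to be irreducible and locally closed, so that its dimension
   is also its local dimension at [a]. Over a non closed field this is the
   algebraic notion (regularity of the local ring of K-valued polynomial
   functions), which implies that S is a manifold near [a]. *)
Definition smooth_at S a : Prop :=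
  exists U : {vspace g},
    (forall v, tangent_space S a v <-> v \in U) /\ krull_dim S (\dim U).

End Zariski.

Section Sheets.
Context {K : fieldType} {g : lieType K}.

Definition centralizer_stratum (k : nat) : set g :=
  [set a : g | \dim (centralizer a) = k].

Definition sheet (S : set g) : Prop :=
  exists k, irreducible_component (centralizer_stratum k) S.

End Sheets.

(* Main.v *)
(** On a sheet the rank r of [ad] is constant, so every minor of size r + 1 of
the matrix of [ad x] is a polynomial in [x] vanishing on the sheet. Bordering
an invertible r x r minor at [a] and differentiating along a tangent vector [v]
shows that [ad v] maps the kernel of [ad a] into its image: for [y] in the
centralizer of [a] there is [u] with [y, v] = [a, u]. For [x] and [y] both in
the centralizer, invariance of the Killing form then gives
<[x, y], v> = <x, [y, v]> = <x, [a, u]> = <[x, a], u> = 0. *)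

From HB Require Import structures.
Require Import Defs.
From mathcomp Require Import all_boot all_algebra classical_sets reals complex.
From mathcomp Require Import mpoly zify.

Set Implicit Arguments.
Unset Strict Implicit.
Unset Printing Implicit Defensive.

Import GRing.Theory passmx.

Local Open Scope ring_scope.

Section Derivation.
Context {K : fieldType} {g : vectType K}.
Implicit Types (p q : {mpoly K[\dim {:g}]}) (a v x : g).

Lemma pdiff_sum a v I (r : seq I) (F : I -> {mpoly K[\dim {:g}]}) :
  pdiff (\sum_(i <- r) F i) a v = \sum_(i <- r) pdiff (F i) a v.
Proof.
rewrite /pdiff [RHS]exchange_big /=; apply: eq_bigr => k _.
by rewrite raddf_sum /peval raddf_sum mulr_suml.
Qed.

Lemma pdiffM p q a v :
  pdiff (p * q) a v = pdiff p a v * peval q a + peval p a * pdiff q a v.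
Proof.
rewrite /pdiff mulr_suml mulr_sumr -big_split /=; apply: eq_bigr => k _.
by rewrite mderivM /peval mevalD !mevalM mulrDl mulrAC mulrA.
Qed.

Definition linear_mpoly (f : {linear g -> K^o}) : {mpoly K[\dim {:g}]} :=
  \sum_(i < \dim {:g}) f (vbasis {:g})`_i *: 'X_i.

Lemma peval_linear_mpoly f x : peval (linear_mpoly f) x = f x.
Proof.
rewrite [x in RHS](coord_vbasis (memvf x)) linear_sum /peval raddf_sum /=.
by apply: eq_bigr => i _; rewrite mevalZ mevalXU mulrC linearZ.
Qed.

Lemma pdiff_linear_mpoly f a v : pdiff (linear_mpoly f) a v = f v.
Proof.
rewrite -[RHS]peval_linear_mpoly /pdiff /linear_mpoly [RHS]/peval raddf_sum /=.
apply: eq_bigr => i _; rewrite mevalZ mevalXU; congr (_ * _).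
rewrite raddf_sum (bigD1 i) //= mderivZ mderivX mnm1E eqxx scale1r.
rewrite big1 => [|j ji]; last first.
  by rewrite mderivZ mderivX mnm1E (negPf ji) scale0r scaler0.
have -> : (U_(i) - U_(i))%MM = 0%MM.
  by apply/mnmP=> j; rewrite mnmBE subnn mnm0E.
by rewrite addr0 /peval mevalZ mpolyX0 meval1 mulr1.
Qed.

(** At [a] the last row of [P] vanishes, so the product rule along that row differentiates only its
    entries and freezes the cofactors at [a]. What results is the determinant of the block
    triangular [Q]. *)
Lemma pdiff_det_border r (P : 'M[{mpoly K[\dim {:g}]}]_(r + 1)) a v :
  map_mx (peval^~ a) P = block_mx 1%:M 0 0 0 ->
  pdiff (\det P) a v = pdiff (drsubmx P 0 0) a v.
Proof.
move=> Pa; pose i0 : 'I_(r + 1) := rshift r 0.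
pose D := \row_j pdiff (P i0 j) a v.
pose Q := block_mx 1%:M 0 (lsubmx D) (rsubmx D).
have Pa0 j : peval (P i0 j) a = 0.
  have := congr1 (fun M : 'M_(r + 1) => M i0 j) Pa.
  by rewrite mxE => ->; rewrite block_mxEv col_mxEd row_mx0 mxE.
have -> : pdiff (\det P) a v = \det Q.
  rewrite (expand_det_row _ i0) pdiff_sum (expand_det_row _ i0).
  apply: eq_bigr => j _; rewrite pdiffM Pa0 mul0r addr0; congr (_ * _).
    by rewrite /Q block_mxEv col_mxEd hsubmxK mxE.
  (* Cofactors along row [i0] omit that row, the only one where [P] at [a] and [Q] differ. *)
  rewrite /peval -cofactor_map_mx /cofactor; congr (_ * \det _).
  apply/matrixP=> s t; do 2!rewrite [RHS]mxE; do 3!rewrite [LHS]mxE.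
  have := congr1 (fun M : 'M_(r + 1) => M (lift i0 s) (lift j t)) Pa.
  rewrite mxE => {}Pa; rewrite [LHS]Pa /Q !block_mxEv.
  case: (split_ordP (lift i0 s)) => k ks; rewrite ks.
    by rewrite !col_mxEu.
  by case/eqP: (neq_lift i0 s); rewrite ks ord1.
by rewrite det_lblock det1 mul1r det_mx11 !mxE; congr pdiff; rewrite !mxE.
Qed.

(* With [L0 *m f a *m N0 = 1], [u *m f a = 0] and [f a *m w = 0], the derivative
   at [a] along [v] of the determinant of [col_mx L0 u *m f x *m row_mx N0 w]
   is [u *m f v *m w]. *)
Lemma tangent_rank_mx m n (f : {linear g -> 'M[K]_(m, n)}) (S : set g) r a v :
  (forall x, S x -> \rank (f x) = r) -> S a -> tangent_space S a v ->
  (kermx (f a) *m f v <= f a)%MS.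
Proof.
move=> rkS Sa Tv; apply/rV_subP => _ /submxP[z ->]; rewrite mulmxA.
set u := z *m _; have ua0 : u *m f a = 0 by rewrite -mulmxA mulmx_ker mulmx0.
(* A row lies in the row space of [f a] iff every column [w] of its cokernel kills it. *)
rewrite submxE; apply/eqP/rowP => j; rewrite [RHS]mxE.
set w := col j (cokermx (f a)).
have aw0 : f a *m w = 0 by rewrite /w colE mulmxA mulmx_coker mul0mx.
(* [N0] and [L0] are one-sided inverses of the two factors of the full-rank factorization of
   [f a]. *)
have [N0 rN] := row_freeP (row_base_free (f a)).
have [L0 Lc] := row_fullP (col_base_full (f a)).
have LN : L0 *m f a *m N0 = 1%:M.
  rewrite -[RHS]rN; congr (_ *m N0).
  by rewrite -[X in L0 *m X]mulmx_base mulmxA Lc mul1mx.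
pose L := col_mx L0 u; pose N := row_mx N0 w.
pose h (i k : 'I_(\rank (f a) + 1)) x : K^o := (L *m f x *m N) i k.
have h_lin i k : linear (h i k).
  move=> c x y; rewrite /h linearP mulmxDr mulmxDl.
  by rewrite -scalemxAr -scalemxAl !mxE.
pose hl i k : {linear g -> K^o} :=
  HB.pack (h i k) (GRing.isLinear.Build K g K^o *:%R (h i k) (h_lin i k)).
pose P := \matrix_(i, k) linear_mpoly (hl i k).
have PE x : map_mx (peval^~ x) P = L *m f x *m N.
  by apply/matrixP => i k; rewrite !mxE peval_linear_mpoly [LHS]mxE.
have P0 x : S x -> peval (\det P) x = 0.
  move=> Sx; rewrite /peval -det_map_mx -/(peval^~ x) PE.
  (* A nonzero determinant at [x] would give [f x] rank at least r + 1. *)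
  apply/eqP/contraT; rewrite -unitfE -unitmxE => /mxrank_unit rkE.
  have: (\rank (L *m f x *m N) <= \rank (f x))%N.
    by rewrite (leq_trans (mxrankM_maxl _ _)) ?mxrankM_maxr.
  by rewrite rkE (rkS x Sx) (rkS a Sa) addn1 ltnn.
have := Tv _ P0; rewrite pdiff_det_border.
  have -> : drsubmx P 0 0 = linear_mpoly (hl (rshift _ 0) (rshift _ 0)).
    by rewrite !mxE.
  rewrite pdiff_linear_mpoly /= /h => <-.
  rewrite /L /N mul_col_mx mul_col_row block_mxEdr /w colE !mulmxA -colE.
  by rewrite [RHS]mxE.
by rewrite PE mul_col_mx ua0 mul_col_row LN !mul0mx -mulmxA aw0 mulmx0.
Qed.

End Derivation.

Section Rank.
Context {K : fieldType} {vT : vectType K}.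
Implicit Types (f : 'End(vT)).
Let e := vbasis {:vT}.
Let e_basis : basis_of {:vT} e := vbasisP {:vT}.

Lemma dim_vsof_le (M : 'M[K]_(\dim {:vT})) : (\dim (vsof e M) <= \rank M)%N.
Proof.
pose X := [tuple vecof e (row i (row_base M)) | i < \rank M].
suff sMX : (vsof e M <= <<X>>)%VS.
  by rewrite (leq_trans (dimvS sMX)) // (leq_trans (dim_span _)) ?size_tuple.
apply/subvP => y; rewrite -rVof_sub // -(eq_row_base M) => /submxP[z yz].
rewrite -[y](rVofK e_basis) yz mulmx_sum_row linear_sum memv_suml // => i _.
rewrite linearZ memvZ // memv_span //; apply/tnthP; exists i.
by rewrite tnth_mktuple.
Qed.

(** The bound [dim_vsof_le] applies to both the image and the kernel; by rank-nullity on each side,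
    neither inequality can be strict. *)
Lemma rank_mxof f : \rank (mxof e e f) = \dim (limg f).
Proof.
have := dim_vsof_le (mxof e e f); rewrite -(limgE e_basis) => le_img.
have := dim_vsof_le (kermx (mxof e e f)).
rewrite -(lker_ker e_basis) mxrank_ker.
move: (limg_ker_dim f {:vT}) (rank_leq_row (mxof e e f)).
by rewrite capfv; lia.
Qed.

(** Coordinate-free form of [tangent_rank_mx]: with row vectors, [lker] becomes the left kernel and
    [limg] the row space. *)
Lemma tangent_rank (g : vectType K) (f : {linear g -> 'End(vT)}) (S : set g) r
    a v :
  (forall x, S x -> \dim (limg (f x)) = r) -> S a -> tangent_space S a v ->
  (f v @: lker (f a) <= limg (f a))%VS.
Proof.
move=> rkS Sa Tv; apply/subvP => _ /memv_imgP[y ya ->].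
rewrite (limgE e_basis) -(rVof_sub e_basis) (rVof_app e e_basis).
have := tangent_rank_mx (f := mxof e e \o f) (r := r) _ Sa Tv => /=.
move=> /(_ (fun x Sx => etrans (rank_mxof _) (rkS x Sx))).
apply: submx_trans; rewrite submxMr //.
by move: ya; rewrite (lker_ker e_basis) -rVof_sub.
Qed.

End Rank.

Section Lie.
Context {K : fieldType} {g : lieType K}.
Implicit Types (x y z a v : g).

Lemma lie_anti x y : lie x y = - lie y x.
Proof.
have := liexx (x + y); rewrite linearD /=.
have addl z : lie (x + y) z = lie x z + lie y z.
  by have := lie_is_linearl z 1 x y; rewrite !scale1r.
by rewrite !addl !liexx add0r addr0 => /addr0_eq <-.
Qed.

Lemma ad_is_linear : linear (@ad K g).
Proof.
move=> c x y; apply/lfunP => z.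
by rewrite add_lfunE scale_lfunE !lfunE /= lie_is_linearl.
Qed.
HB.instance Definition _ :=
  GRing.isLinear.Build K g 'End(g) *:%R (@ad K g) ad_is_linear.

Lemma ad_lie x y : ad (lie x y) = ((ad x \o ad y) - (ad y \o ad x))%VF.
Proof.
apply/lfunP => z; rewrite [LHS]lfunE /=.
have := lie_jacobi x y z.
rewrite (lie_anti z (lie x y)) (lie_anti z x) linearN /= => /subr0_eq.
by move=> <-; rewrite add_lfunE opp_lfunE !comp_lfunE !lfunE.
Qed.

Let M x := mxof (vbasis {:g}) (vbasis {:g}) (ad x).

Lemma killingE x y : killing x y = \tr (M y *m M x).
Proof. by rewrite /killing (mxof_comp _ _ (vbasisP _)). Qed.

Lemma killing_is_linearl y : linear (killing^~ y : g -> K^o).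
Proof. by move=> c x z; rewrite !killingE /M !linearP. Qed.

Lemma killingC x y : killing x y = killing y x.
Proof. by rewrite !killingE mxtrace_mulC. Qed.

(** Once [ad (lie x y)] is expanded as a commutator, this is cyclicity of the trace. *)
Lemma killing_lie x y z : killing (lie x y) z = killing x (lie y z).
Proof.
rewrite !killingE /M !ad_lie !linearB /= !(mxof_comp _ _ (vbasisP _)).
rewrite mulmxBl linearB /= !mulmxA; congr (_ - _).
by rewrite mxtrace_mulC mulmxA.
Qed.

Lemma derived_centralizer_orthogonal a v x :
  (ad v @: centralizer a <= limg (ad a))%VS ->
  x \in derived_algebra (centralizer a) -> killing x v = 0.
Proof.
move=> va; pose k : {linear g -> K^o} :=
  HB.pack (killing^~ v)
    (GRing.isLinear.Build K g K^o *:%R _ (killing_is_linearl v)).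
suff sk : (derived_algebra (centralizer a) <= lker (linfun k))%VS.
  by move=> /(subvP sk); rewrite memv_ker (lfunE k) => /eqP.
apply/span_subvP => _ /allpairsP[[y z] /= [/vbasis_mem ya /vbasis_mem za ->]].
rewrite memv_ker (lfunE k) /= killing_lie lie_anti.
have /memv_imgP[u _] : ad v z \in limg (ad a).
  by rewrite (subvP va) // memv_img.
(* With [v, z] = [a, u], the value is <y, [u, a]> = <u, [a, y]>, and [a, y] = 0. *)
rewrite !lfunE /= => ->; move: ya; rewrite mem_centralizer => /eqP ya.
rewrite -(lie_anti u) killingC killing_lie ya.
by rewrite killingE /M !linear0 mul0mx linear0.
Qed.

Lemma dim_limg_ad k a : centralizer_stratum k a ->
  \dim (limg (ad a)) = (\dim {:g} - k)%N.
Proof. by move=> <-; rewrite -(limg_ker_dim (ad a) {:g}) capfv addKn. Qed.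

End Lie.

Theorem proposition3p1 (K : fieldType) (hK : real_or_complex K)
    (g : lieType K) (hg : lie_semisimple g) (S : set g) (hS : sheet S)
    (a : g) (haS : S a) (hsm : smooth_at S a) (x v : g)
    (hx : x \in derived_algebra (centralizer a)) (hv : tangent_space S a v) :
  killing x v = 0%R.
Proof.
have [k [Sk _ _]] := hS.
apply: derived_centralizer_orthogonal hx.
(* The sheet lies in one stratum, so [ad] has constant rank dim g - k on it. *)
by apply: tangent_rank haS hv => y /Sk; apply: dim_limg_ad.
Qed.
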